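(* Consider the affine control system on $\mathbb{R}^n$ $$\dot{x}(t)=A_{0}x(t)+a_{0}+\sum_{i=1}^{m}u_{i}(t)[A_{i}x(t)+a_{i}],\quad u\in\mathcal{U},$$ its control flow $\Psi$ on $\mathcal{U}\times\mathbb{R}^{n}$, and the control flow $\mathbb{S}\Psi^{1,+}$ on $\mathcal{U}\times\mathbb{S}^{n,+}$ of the induced control system on the open northern hemisphere $\mathbb{S}^{n,+}$ of the Poincaré sphere. Let $h:\mathbb{R}^n\to\mathbb{S}^{n,+}$, $h(x)=\frac{(x,1)}{\|(x,1)\|}$. (i) The map $\mathrm{id}_{\mathcal{U}}\times h:\mathcal{U}\times\mathbb{R}^{n}\rightarrow\mathcal{U}\times\mathbb{S}^{n,+}$ is a topological conjugation of the flows $\Psi$ and $\mathbb{S}\Psi^{1,+}$ (i.e., a homeomorphism), hence $$(\mathrm{id}_{\mathcal{U}}\times h)\Psi_{t}(u,x)=\mathbb{S}\Psi_{t}^{1,+}(u,h(x))\quad\text{for }t\in\mathbb{R},\ (u,x)\in\mathcal{U}\times\mathbb{R}^{n}.$$ (ii) The maximal invariant strongly chain transitive sets for $\Psi$ are mapped by $\mathrm{id}_{\mathcal{U}}\times h$ onto the maximal invariant strongly chain transitive sets for $\mathbb{S}\Psi^{1,+}$.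
   Context: Setting. $A_i\in\mathbb{R}^{n\times n}$, $a_i\in\mathbb{R}^n$, $i=0,\ldots,m$; $\Omega\subset\mathbb{R}^m$ is a convex and compact neighborhood of $0$; $\mathcal{U}=\{u\in L^\infty(\mathbb{R},\mathbb{R}^m)\mid u(t)\in\Omega\text{ for almost all }t\}$, with a metric compatible with the weak$^\ast$ topology of $L^\infty(\mathbb{R},\mathbb{R}^m)$ (then $\mathcal{U}$ is compact). The solutions of the affine system with $x(0)=x$ are denoted $\psi(t,x,u)$, $t\in\mathbb{R}$, and $\Psi_t(u,x)=(u(t+\cdot),\psi(t,x,u))$. Induced system. The affine system is embedded in the bilinear system on $\mathbb{R}^{n+1}$ $$\begin{pmatrix} \dot x \\ \dot z \end{pmatrix}=\begin{pmatrix} A_0 & a_0 \\ 0 & 0 \end{pmatrix}\begin{pmatrix} x \\ z \end{pmatrix}+\sum_{i=1}^m u_i(t)\begin{pmatrix} A_i & a_i \\ 0 & 0 \end{pmatrix}\begin{pmatrix} x \\ z \end{pmatrix},$$ with trajectories $\psi^1(t,x,z,u)$. Its radial projection to the unit sphere $\mathbb{S}^n\subset\mathbb{R}^{n+1}$ has trajectories $\mathbb{S}\psi^1(t,s,u)=\psi^1(t,s,u)/\|\psi^1(t,s,u)\|$ for $s\in\mathbb{S}^n$. The set $\mathbb{S}^{n,+}=\{s\in\mathbb{S}^n\mid s_{n+1}>0\}$ is invariant; $\mathbb{S}\psi^{1,+}$ denotes the restriction to $\mathbb{S}^{n,+}$ and $\mathbb{S}\Psi^{1,+}_t(u,s)=(u(t+\cdot),\mathbb{S}\psi^{1,+}(t,s,u))$.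 $\|\cdot\|$ is the Euclidean norm. On $\mathbb{S}^{n,+}$ use the metric $d(s,s')=\max_i|s_i-s'_i|$, on $\mathbb{R}^n$ the maximum norm, and on products the maximum metric. Strong chain transitivity for a continuous flow $\phi$ on a metric space $(X,d)$. Let $\mathcal{P}(X)$ be the set of continuous functions $\varepsilon:X\to(0,\infty)$. For $\varepsilon\in\mathcal{P}(X)$, $T>0$, an $(\varepsilon,T)$-chain from $x$ to $y$ consists of $k\ge1$, points $x_0=x,\ldots,x_k=y$ in $X$ and times $t_0,\ldots,t_{k-1}\ge T$ with $d(\phi(t_j,x_j),x_{j+1})<\varepsilon(\phi(t_j,x_j))$ for all $j$. A set $Y\subset X$ is strongly chain transitive if for all $x,y\in Y$, $T>0$, $\varepsilon\in\mathcal{P}(X)$ there is an $(\varepsilon,T)$-chain from $x$ to $y$. Invariant means $\phi(t,Y)\subset Y$ for all $t\in\mathbb{R}$; maximal is with respect to inclusion among invariant strongly chain transitive sets. *)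

(* Defs.v *)
From HB Require Import structures.
From mathcomp Require Export all_boot all_order all_algebra.
From mathcomp Require Export all_classical all_reals all_analysis.
From mathcomp Require Import ess_sup_inf lra.

Set Implicit Arguments.
Unset Strict Implicit.
Unset Printing Implicit Defensive.

Import Order.TTheory GRing.Theory Num.Theory.
Import numFieldNormedType.Exports.

Local Open Scope classical_set_scope.
Local Open Scope quotient_scope.
Local Open Scope ring_scope.

Section TimeShift.
Context {R : realType}.
Local Notation mu := (@lebesgue_measure R).
Local Notation mR := (measurableTypeR R).

Lemma measurable_translation (t : R) :
  measurable_fun setT (fun s : mR => (t + s : mR)).
Proof. exact: measurable_realfun.measurable_funD. Qed.

Definition translation (t : R) : {mfun mR >-> mR} :=
  mfun_Sub (mem_set (measurable_translation t)).

Lemma lebesgue_measure_translation (t : R) (A : set mR) :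
  measurable A -> mu (translation t @^-1` A) = mu A.
Proof.
move=> mA.
rewrite [RHS](@lebesgue_measure_unique R (pushforward mu (translation t))) //.
move=> _ [[a b] _ <-]; rewrite /pushforward /=.
have pre : (fun s => t + s) @^-1` `]a, b]%classic = `](a - t), (b - t)]%classic.
  by apply/seteqP; split => s; rewrite /= !in_itv /= => /andP[? ?];
    apply/andP; split; lra.
rewrite [RHS](_ : _ = mu `](a - t), (b - t)]%classic); last by rewrite -pre.
rewrite !lebesgue_measure_itv /= !lte_fin ltrD2r.
by case: ifP => // _; rewrite -!EFinD; congr _%:E; lra.
Qed.

Lemma ae_translation (t : R) (P : R -> Prop) :
  (\forall s \ae mu, P s) -> \forall s \ae mu, P (t + s).
Proof.
move=> [N [mN N0 PN]]; exists ((fun s => t + s) @^-1` N); split.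
- by rewrite -[_ @^-1` _]setTI; exact: measurable_translation.
- by rewrite lebesgue_measure_translation.
- by move=> s Ps; apply: PN.
Qed.

Definition shift_mfun (t : R) (f : {mfun mR >-> mR}) : {mfun mR >-> mR} :=
  mfun_Sub (mem_set (measurableT_comp (@measurable_funPT _ _ _ _ f)
                                      (measurable_translation t))).

Definition shift_ae (t : R) (f : {mfun_ mu, mR >-> mR}) :
    {mfun_ mu, mR >-> mR} :=
  \pi_({mfun_ mu, mR >-> mR}) (shift_mfun t (repr f)).

Lemma shift_aeE (t : R) (f : {mfun_ mu, mR >-> mR}) :
  \forall s \ae mu, shift_ae t f s = f (t + s).
Proof.
have /eqmodP/asboolP : repr (shift_ae t f) = shift_mfun t (repr f)
    %[mod {mfun_ mu, mR >-> mR}] by rewrite reprK.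
by apply: filterS => s /(_ I).
Qed.

Lemma finite_norm_shift (t : R) (f : {mfun_ mu, mR >-> mR}) :
  finite_norm mu +oo f -> finite_norm mu +oo (shift_ae t f).
Proof.
rewrite /finite_norm unlock; case: ifP => // _; apply: le_lt_trans.
apply/ess_supP.
have := ae_translation t (@ess_sup_ge _ _ _ mu (abse \o (EFin \o f))).
by apply: filterS2 (shift_aeE t f) => s /= ->.
Qed.

Definition shift_class (t : R) (u : LspaceType mu (leey 1)) :
    LspaceType mu (leey 1) :=
  LebesgueSpace.Pack (LebesgueSpace.Class
    (isFinLebesgue.Build _ _ _ mu _ (leey 1) _
      (finite_norm_shift t (@Lebesgue_finite _ _ _ _ _ _ u)))).

End TimeShift.

Section Controls.
Context {R : realType} (m : nat).
Local Notation mu := (@lebesgue_measure R).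

Definition Linfty : Type := 'I_m -> LspaceType mu (leey 1).
Definition L1 : Type := 'I_m -> LspaceType1 mu.

Definition pairing (u : Linfty) (y : L1) : R :=
  \int[mu]_t (\sum_(i < m) u i t * y i t).

HB.instance Definition _ := gen_eqMixin Linfty.
HB.instance Definition _ := gen_choiceMixin Linfty.
(* The weak* topology: the coarsest one for which every [pairing^~ y] is
   continuous. *)
HB.instance Definition _ := Topological.copy Linfty
  (sup_topology (fun y : L1 =>
    Topological.on (initial_topology (fun u : Linfty => pairing u y : R^o)))).

Definition control_at (u : Linfty) (t : R) : 'cV[R]_m := \col_i u i t.

Definition controls (Omega : set 'cV[R]_m) : set Linfty :=
  [set u | \forall t \ae mu, Omega (control_at u t)].

Definition shift_control (t : R) (u : Linfty) : Linfty :=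
  fun i => shift_class t (u i).

End Controls.
Arguments Linfty R m : clear implicits.
Arguments L1 R m : clear implicits.

Section Trajectories.
Context {R : realType} (m k : nat).
Local Notation mu := (@lebesgue_measure R).

Definition oriented_integral (f : R -> R) (t : R) : R :=
  if 0 <= t then \int[mu]_(s in `[0, t]) f s else - \int[mu]_(s in `[t, 0]) f s.

(* Caratheodory solutions, in integral form.  When [x] is continuous and
   [f w y] is affine in [w] and in [y], the integrands below are measurable and
   essentially bounded on compact intervals, hence integrable there. *)
Definition is_trajectory (f : 'cV[R]_m -> 'cV[R]_k -> 'cV[R]_k)
    (u : Linfty R m) (x0 : 'cV[R]_k) (x : R -> 'cV[R]_k) : Prop :=
  continuous x /\
  forall (t : R) (i : 'I_k), x t i 0 =
    x0 i 0 + oriented_integral (fun s => f (control_at u s) (x s) i 0) t.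

(* The default value of [xget] is immaterial: for the two right-hand sides used
   below there is exactly one trajectory through each [x0]. *)
Definition trajectory (f : 'cV[R]_m -> 'cV[R]_k -> 'cV[R]_k) (t : R)
    (x0 : 'cV[R]_k) (u : Linfty R m) : 'cV[R]_k :=
  xget (fun=> x0) [set x | is_trajectory f u x0 x] t.

End Trajectories.

Section Systems.
Context {R : realType} (n m : nat).
(* The index [ord0] is the drift, [lift ord0 i] goes with the control [u_i]. *)
Variables (A : 'I_m.+1 -> 'M[R]_n) (a : 'I_m.+1 -> 'cV[R]_n).

Definition affine_rhs (w : 'cV[R]_m) (x : 'cV[R]_n) : 'cV[R]_n :=
  A ord0 *m x + a ord0
  + \sum_(i < m) w i 0 *: (A (lift ord0 i) *m x + a (lift ord0 i)).

Definition psi := trajectory affine_rhs.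

Definition Psi (t : R) (p : Linfty R m * 'cV[R]_n) : Linfty R m * 'cV[R]_n :=
  (shift_control t p.1, psi t p.2 p.1).

Definition induced_mx (i : 'I_m.+1) : 'M[R]_(n + 1) :=
  block_mx (A i) (a i) 0 0.

Definition induced_rhs (w : 'cV[R]_m) (y : 'cV[R]_(n + 1)) : 'cV[R]_(n + 1) :=
  induced_mx ord0 *m y
  + \sum_(i < m) w i 0 *: (induced_mx (lift ord0 i) *m y).

Definition psi1 := trajectory induced_rhs.

Definition enorm (k : nat) (y : 'cV[R]_k) : R :=
  Num.sqrt (\sum_(i < k) y i 0 ^+ 2).

Definition Spsi1 (t : R) (s : 'cV[R]_(n + 1)) (u : Linfty R m) :
    'cV[R]_(n + 1) :=
  (enorm (psi1 t s u))^-1 *: psi1 t s u.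

Definition SPsi1 (t : R) (p : Linfty R m * 'cV[R]_(n + 1)) :
    Linfty R m * 'cV[R]_(n + 1) :=
  (shift_control t p.1, Spsi1 t p.2 p.1).

Definition hemisphere : set 'cV[R]_(n + 1) :=
  [set s | enorm s = 1 /\ 0 < s (rshift n ord0) 0].

Definition poincare (x : 'cV[R]_n) : 'cV[R]_(n + 1) :=
  (enorm (col_mx x 1))^-1 *: col_mx x 1.

Definition id_poincare (p : Linfty R m * 'cV[R]_n) :
    Linfty R m * 'cV[R]_(n + 1) :=
  (p.1, poincare p.2).

End Systems.

Section Metrics.
Context {R : realType}.

Definition metric_on (T : Type) (X : set T) (d : T -> T -> R) : Prop :=
  [/\ forall x y, X x -> X y -> (d x y = 0 <-> x = y),
      forall x y, X x -> X y -> d x y = d y x &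
      forall x y z, X x -> X y -> X z -> d x z <= d x y + d y z].

(* [d] induces on [X] the subspace topology inherited from [T]. *)
Definition compatible_on (T : topologicalType) (X : set T) (d : T -> T -> R) :
    Prop :=
  forall (x : T) (N : set T), X x ->
    (within X (nbhs x) N <->
     exists2 e : R, 0 < e & forall y, X y -> d x y < e -> N y).

(* The library's norm on matrix types is the maximum norm. *)
Definition max_dist (m k : nat) (d : Linfty R m -> Linfty R m -> R)
    (p q : Linfty R m * 'cV[R]_k) : R :=
  Num.max (d p.1 q.1) `|p.2 - q.2|.

End Metrics.

(* A flow on a subspace [X] of a topological space [T] is given by a map
   [phi : R -> T -> T], only its values on [X] being relevant, and the metric
   of [X] by a function [d] compatible with the topology of [X]. *)
Section Flows.
Context {R : realType}.

Definition homeomorphism_on (T T' : topologicalType) (X : set T) (X' : set T')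
    (h : T -> T') : Prop :=
  [/\ set_bij X X' h, {within X, continuous h} &
      exists g : T' -> T,
        {within X', continuous g} /\ (forall x, X x -> g (h x) = x)].

Definition topological_conjugation (T T' : topologicalType)
    (X : set T) (X' : set T') (phi : R -> T -> T) (phi' : R -> T' -> T')
    (h : T -> T') : Prop :=
  homeomorphism_on X X' h /\
  forall t x, X x -> h (phi t x) = phi' t (h x).

Variables (T : topologicalType) (X : set T) (d : T -> T -> R).
Variable (phi : R -> T -> T).

Definition positive_continuous (eps : T -> R) : Prop :=
  {within X, continuous eps} /\ forall x, X x -> 0 < eps x.

Definition eps_chain (eps : T -> R) (tau : R) (p q : T) : Prop :=
  exists (k : nat) (x : nat -> T) (t : nat -> R),
    [/\ (0 < k)%N, x 0%N = p, x k = q,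
        forall j, (j <= k)%N -> X (x j) &
        forall j, (j < k)%N ->
          tau <= t j /\
          d (phi (t j) (x j)) (x j.+1) < eps (phi (t j) (x j))].

Definition strongly_chain_transitive (Y : set T) : Prop :=
  forall p q, Y p -> Y q -> forall (tau : R) (eps : T -> R),
    0 < tau -> positive_continuous eps -> eps_chain eps tau p q.

Definition invariant_under (Y : set T) : Prop :=
  forall t y, Y y -> Y (phi t y).

Definition invariant_sct (Y : set T) : Prop :=
  [/\ Y `<=` X, invariant_under Y & strongly_chain_transitive Y].

Definition maximal_invariant_sct : set (set T) :=
  [set Y | invariant_sct Y /\
     forall Z, invariant_sct Z -> Y `<=` Z -> Z = Y].

End Flows.

(* Main.v *)
Require Import Defs.
From mathcomp Require Import all_boot all_order all_algebra.
From mathcomp Require Import all_classical all_reals all_analysis.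
From mathcomp Require Import ess_sup_inf measurable_realfun ring lra.
Import Order.TTheory GRing.Theory Num.Theory.
Import numFieldNormedType.Exports.
Local Open Scope classical_set_scope.
Local Open Scope ring_scope.

(* The bilinear extension leaves the last coordinate constant, so the curves
   [c (x, 1)] with [c > 0] that solve the induced system are exactly those for
   which [x] solves the affine one; normalising gives the conjugation.  The only
   analytic ingredient is uniqueness of the trajectories, by Gronwall's lemma
   applied forwards and backwards in time.  A homeomorphism of metric spaces
   carries strong chains to strong chains because, for every positive continuous
   function [eps'] on the target, continuity of the map admits a modulus that is
   a positive continuous function of the base point. *)

(** * Images of strong chains under continuous maps that intertwine two flows *)

Section ChainTransfer.
Context {R : realType} {T T' : topologicalType}.
Context {X : set T} {X' : set T'} {d : T -> T -> R} {d' : T' -> T' -> R}.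
Context (d_metric : metric_on X d) (d'_metric : metric_on X' d').
Context (d_compat : compatible_on X d) (d'_compat : compatible_on X' d').

Lemma metric_on_refl {x : T} : X x -> d x x = 0.
Proof. by move=> Xx; case: d_metric => d0 _ _; apply/d0. Qed.

(** Nonnegativity is not a clause of [metric_on]; it follows from the triangle inequality along [x],
    [y], [x]. *)
Lemma metric_on_ge0 {x y : T} : X x -> X y -> 0 <= d x y.
Proof.
move=> Xx Xy; case: (d_metric) => d0 dC dD.
have := dD x y x Xx Xy Xx; rewrite metric_on_refl // [d y x]dC //; lra.
Qed.

Lemma within_ball_of {e : R} {x : T} : X x -> 0 < e ->
  within X (nbhs x) [set y | d x y < e].
Proof. by move=> Xx e0; apply/d_compat => //; exists e. Qed.

Context {h : T -> T'} (hXX' : forall x, X x -> X' (h x)).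
Context (h_cont : {within X, continuous h}).

(* The largest admissible radius around [x] is a 1-Lipschitz function of [x],
   which gives continuity for free. *)
Lemma variable_modulus (eps' : T' -> R) : positive_continuous X' eps' ->
  exists delta : T -> R, positive_continuous X delta /\
    forall x y, X x -> X y -> d x y < delta x -> d' (h x) (h y) < eps' (h x).
Proof.
move=> [eps'_cont eps'_gt0].
case: (d_metric) => d0 dC dD.
(* Quantifying over two points of the ball, rather than over the centre and one point, makes
   admissibility pass to smaller balls around other centres. The cap 1 keeps the supremum finite. *)
pose good x := [set r : R | 0 <= r <= 1 /\ forall y z, X y -> X z ->
  d x y < r -> d x z < r -> d' (h y) (h z) < eps' (h y)].
have good0 x : X x -> good x 0.
  move=> Xx; split; first by rewrite lexx ler01.
  by move=> y z Xy Xz; rewrite ltNge metric_on_ge0.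
have good_sup x : X x -> has_sup (good x).
  by move=> Xx; split; [exists 0; exact: good0 | exists 1 => r [/andP[]]].
have sup_ge x r : X x -> good x r -> r <= sup (good x).
  by move=> Xx gr; apply: ub_le_sup => //; case: (good_sup x Xx).
have sup_gt0 x : X x -> 0 < sup (good x).
  move=> Xx; have X'hx := hXX' _ Xx; have e0 := eps'_gt0 _ X'hx.
  set e := eps' (h x) in e0.
  have eps_near : within X' (nbhs (h x)) [set z | e / 2 < eps' z].
    have /subspace_continuousP/(_ _ X'hx) := eps'_cont.
    move=> /cvgrPdist_lt /(_ (e / 2)) /=; rewrite divr_gt0 // => /(_ isT).
    apply: filterS => z; rewrite /from_subspace -/e ltr_norml => /andP[_ ?] /=.
    by lra.
  have [r1 r10 eps1] := (d'_compat _ _ X'hx).1 eps_near.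
  (* Two images within [e / 4] of [h x] are less than [e / 2] apart, and within [r1] of [h x] the
     value of [eps'] exceeds [e / 2]. *)
  pose s := Num.min r1 (e / 4).
  have s0 : 0 < s by rewrite lt_min r10 divr_gt0.
  have : within X (nbhs x) [set y | d' (h x) (h y) < s].
    have dnear : within X' (nbhs (h x)) [set z | d' (h x) z < s].
      by apply/d'_compat => //; exists s.
    have /subspace_continuousP h_cvg := h_cont.
    have : nbhs x [set y | X y -> X' (h y) -> d' (h x) (h y) < s].
      exact: h_cvg dnear.
    by apply: filterS => y /= dy Xy; exact: (dy Xy (hXX' _ Xy)).
  move=> /(d_compat _ _ Xx)[r r0 dr].
  case: (d'_metric) => _ dC' dD'.
  apply: (@lt_le_trans _ _ (Num.min r 1)); first by rewrite lt_min r0 ltr01.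
  apply: sup_ge => //; split.
    by rewrite le_min (ltW r0) ler01 ge_min lexx orbT.
  move=> y z Xy Xz; rewrite !lt_min => /andP[dy _] /andP[dz _].
  have X'y := hXX' _ Xy; have X'z := hXX' _ Xz.
  have := dr y Xy dy; rewrite /= lt_min => /andP[y1 y2].
  have := dr z Xz dz; rewrite /= lt_min => /andP[_ z2].
  have := dD' (h y) (h x) (h z) X'y X'hx X'z; rewrite [d' (h y) (h x)]dC' //.
  have := eps1 (h y) X'y y1; rewrite /=; lra.
(* The ball of radius [r - d x y] around [y] lies in the ball of radius [r] around [x], so it
   inherits admissibility; if that radius is not positive, [sup_gt0] suffices. *)
have sup_lip x y : X x -> X y -> sup (good x) - d x y <= sup (good y).
  move=> Xx Xy; rewrite lerBlDr; apply: ge_sup; first by exists 0; exact: good0.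
  move=> r [/andP[r0 r1] gr]; rewrite -lerBlDr.
  have [|rd] := leP (r - d x y) 0.
    by move=> h0; apply: le_trans h0 _; exact/ltW/sup_gt0.
  apply: sup_ge => //; split.
    by rewrite (ltW rd) /=; have := metric_on_ge0 Xx Xy; lra.
  move=> z w Xz Xw dz dw; apply: gr => //.
    by apply: le_lt_trans (dD _ _ _ Xx Xy Xz) _; lra.
  by apply: le_lt_trans (dD _ _ _ Xx Xy Xw) _; lra.
exists (fun x => sup (good x) / 2); split; first split.
- apply/subspace_continuousP => x Xx; apply/cvgrPdist_lt => e e0 /=.
  have Xnear : within X (nbhs x) X by exact: withinT.
  apply: filterS2 (within_ball_of Xx e0) Xnear => y /= dxy Xy.
  have := sup_lip _ _ Xx Xy; have := sup_lip _ _ Xy Xx; rewrite [d y x]dC //.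
  have half_lip (a b c r : R) : 0 < r -> c < r -> a - c <= b -> b - c <= a ->
      (- r < b / 2 - a / 2) && (b / 2 - a / 2 < r).
    by move=> *; apply/andP; split; lra.
  by rewrite /from_subspace ltr_norml => ? ?; exact: half_lip e0 dxy _ _.
- by move=> x Xx; rewrite divr_gt0 // sup_gt0.
(* Some admissible [r] exceeds half of the supremum; it is applied with the centre [x] as the first
   of the two points. *)
- move=> x y Xx Xy dxy.
  have := sup_gt0 x Xx => s0.
  have : 0 < sup (good x) / 2 by rewrite divr_gt0.
  move=> /sup_adherent /(_ (good_sup x Xx))[r [r01 gr] rs].
  apply: gr => //; rewrite ?metric_on_refl //; first lra.
  by apply: lt_trans dxy _; lra.
Qed.

Context {phi : R -> T -> T} {phi' : R -> T' -> T'}.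
Context (phiX : invariant_under phi X).
Context (h_conj : forall t x, X x -> h (phi t x) = phi' t (h x)).

(** A chain for the modulus [delta] maps to a chain for [eps'] with the same times: both tolerances
    are evaluated at the point where the flow arrives, before the jump. Stated for one direction, so
    that it serves both a conjugation and its inverse. *)
Lemma invariant_sct_image (Y : set T) :
  invariant_sct X d phi Y -> invariant_sct X' d' phi' (h @` Y).
Proof.
move=> [YX Yinv Ysct]; split.
- by move=> _ [y Yy <-]; exact/hXX'/YX.
- by move=> t _ [y Yy <-]; exists (phi t y); [exact: Yinv | apply/h_conj/YX].
move=> _ _ [p Yp <-] [q Yq <-] tau eps' tau0 /variable_modulus[delta [dpc dlt]].
have [k [x [t [k0 x0 xk xX xlt]]]] := Ysct p q Yp Yq tau delta tau0 dpc.
exists k, (h \o x), t; split=> //=; rewrite ?x0 ?xk // => j jk.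
  exact/hXX'/xX.
have [tj dj] := xlt j jk; split=> //; have Xj := xX j (ltnW jk).
by rewrite -h_conj //; apply: dlt => //; [exact: phiX | exact: xX].
Qed.

End ChainTransfer.

(** * Maximal invariant strongly chain transitive sets under conjugation *)

Section ConjugationTransfer.
Context {R : realType} {T T' : topologicalType}.
Context {X : set T} {X' : set T'} {d : T -> T -> R} {d' : T' -> T' -> R}.
Context {phi : R -> T -> T} {phi' : R -> T' -> T'} {h : T -> T'}.

(** Taking images under [h] and under its inverse [g] gives mutually inverse, inclusion-preserving
    maps between the invariant strongly chain transitive sets of the two flows, so maximal elements
    correspond. *)
Lemma maximal_invariant_sct_conjugation :
  metric_on X d -> metric_on X' d' -> compatible_on X d ->
  compatible_on X' d' -> invariant_under phi X ->
  topological_conjugation X X' phi phi' h ->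
  [set h @` Y | Y in maximal_invariant_sct X d phi] =
  maximal_invariant_sct X' d' phi'.
Proof.
move=> dm d'm dc d'c phiX [[[hXX' hinj hsurj] hc [g [gc gh]]] hphi].
have {}hXX' x : X x -> X' (h x) by move=> Xx; apply: hXX'.
have hg y : X' y -> h (g y) = y by move=> /hsurj[x Xx <-]; rewrite gh.
have gX y : X' y -> X (g y) by move=> /hsurj[x Xx <-]; rewrite gh.
have phiX' : invariant_under phi' X'.
  by move=> t y /hsurj[x Xx <-]; rewrite -hphi //; exact/hXX'/phiX.
have gphi t y : X' y -> g (phi' t y) = phi t (g y).
  by move=> /hsurj[x Xx <-]; rewrite -hphi // !gh //; exact: phiX.
have img := @invariant_sct_image _ _ _ _ _ _ _ dm d'm dc d'c _ hXX' hc
              _ _ phiX hphi.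
have img' := @invariant_sct_image _ _ _ _ _ _ _ d'm dm d'c dc _ gX gc
              _ _ phiX' gphi.
have ghY Y : Y `<=` X -> g @` (h @` Y) = Y.
  move=> YX; apply/seteqP; split=> [_ [_ [y Yy <-] <-]|y Yy].
    by rewrite gh //; exact: YX.
  by exists (h y); [exists y | rewrite gh //; exact: YX].
have hgZ Z : Z `<=` X' -> h @` (g @` Z) = Z.
  move=> ZX; apply/seteqP; split=> [_ [_ [y Zy <-] <-]|y Zy].
    by rewrite hg //; exact: ZX.
  by exists (g y); [exists y | rewrite hg //; exact: ZX].
apply/seteqP; split=> [_ [Y [Yi Ymax] <-]|Z [Zi Zmax]].
- split; first exact: img.
  move=> Z Zi YZ; have ZX' : Z `<=` X' by case: Zi.
  have YX : Y `<=` X by case: Yi.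
  rewrite -(hgZ Z ZX'); congr (h @` _); apply: Ymax; first exact: img'.
  by rewrite -(ghY Y YX); exact: image_subset.
- have ZX' : Z `<=` X' by case: Zi.
  exists (g @` Z); last exact: hgZ.
  split; first exact: img'.
  move=> Y Yi ZY; have YX : Y `<=` X by case: Yi.
  rewrite -(ghY Y YX); congr (g @` _); apply: Zmax; first exact: img.
  by rewrite -(hgZ Z ZX'); exact: image_subset.
Qed.

End ConjugationTransfer.

(** * The maximum metric on controls times states *)

Section ProductMetric.
Context {R : realType} {m k : nat} {C : set (Linfty R m)} {S : set 'cV[R]_k}.
Context {dU : Linfty R m -> Linfty R m -> R}.

Lemma metric_on_max_dist : metric_on C dU -> metric_on (C `*` S) (max_dist dU).
Proof.
move=> [d0 dC dD].
have d_ge0 u v : C u -> C v -> 0 <= dU u v.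
  move=> Cu Cv; have := dD u v u Cu Cv Cu.
  by rewrite (d0 u u Cu Cu).2 // (dC v u) //; lra.
split.
- move=> [u x] [v y] [/= Cu _] [/= Cv _]; rewrite /max_dist /=; split.
    move=> /eqP; rewrite eq_le ge_max => /andP[/andP[duv dxy] _].
    congr pair; first by apply/(d0 u v Cu Cv)/eqP; rewrite eq_le duv d_ge0.
    by apply/eqP; rewrite -subr_eq0 -normr_le0.
  by move=> [<- <-]; rewrite (d0 u u Cu Cu).2 // subrr normr0 maxxx.
- move=> [u x] [v y] [/= Cu _] [/= Cv _].
  by rewrite /max_dist /= dC // distrC.
- move=> [u x] [v y] [w z] [/= Cu _] [/= Cv _] [/= Cw _].
  rewrite /max_dist /= ge_max; apply/andP; split.
    by apply: le_trans (dD u v w Cu Cv Cw) _; rewrite lerD // le_max lexx.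
  apply: le_trans (ler_distD y _ _) _.
  by rewrite lerD // le_max lexx orbT.
Qed.

(** A ball of the maximum metric is a product of balls, and a neighbourhood rectangle contains the
    ball whose radius is the smaller of the two radii. *)
Lemma compatible_on_max_dist :
  compatible_on C dU -> compatible_on (C `*` S) (max_dist dU).
Proof.
move=> dU_compat [u x] N [/= Cu Sx]; split.
- move=> [[Q1 Q2] [/= Q1u Q2x] QN].
  have [|e1 e10 He1] := (dU_compat u Q1 Cu).1.
    by apply: filterS Q1u => v Qv _.
  have /nbhs_ballP[e2 /= e20 He2] := Q2x.
  exists (Num.min e1 e2); first by rewrite lt_min e10.
  move=> [v y] [/= Cv Sy]; rewrite /max_dist /= gt_max !lt_min.
  move=> /andP[/andP[d1 _] /andP[_ d2]].
  apply: (QN (v, y)); last by split.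
  by split; [exact: He1 | apply: He2; rewrite -ball_normE].
- move=> [e e0 HN].
  have Cnear : within C (nbhs u) [set v | dU u v < e].
    by apply/dU_compat => //; exists e.
  exists ([set v | C v -> dU u v < e], ball x e).
    by split => //=; exact: nbhsx_ballx.
  move=> [v y] [/= dv]; rewrite -ball_normE /= => dy [/= Cv Sy].
  by apply: HN => //; rewrite /max_dist /= gt_max dv.
Qed.

End ProductMetric.

(** * The homeomorphism between Euclidean space and the open hemisphere *)

Section Homeomorphism.
Context {R : realType} {n m : nat}.

Lemma enormZ (k : nat) (c : R) (y : 'cV[R]_k) : enorm (c *: y) = `|c| * enorm y.
Proof.
rewrite /enorm -sqrtr_sqr -sqrtrM ?sqr_ge0 //; congr Num.sqrt.
by rewrite mulr_sumr; apply: eq_bigr => i _; rewrite mxE exprMn.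
Qed.

Lemma enorm_lift_gt0 (x : 'cV[R]_n) : 0 < enorm (col_mx x (1 : 'cV[R]_1)).
Proof.
rewrite sqrtr_gt0 big_split_ord /= big_ord1 col_mxEd mxE eqxx expr1n.
by apply: ltr_wpDl => //; apply: sumr_ge0 => i _; exact: sqr_ge0.
Qed.

Lemma poincare_hemisphere (x : 'cV[R]_n) : hemisphere (poincare x).
Proof.
have x0 := enorm_lift_gt0 x; split.
  by rewrite enormZ gtr0_norm ?invr_gt0 // mulVf // gt_eqF.
by rewrite mxE col_mxEd mxE eqxx mulr1 invr_gt0.
Qed.

(** The gnomonic projection: the ray through [s] is intersected with the hyperplane where the last
    coordinate is 1. It is the inverse of [poincare]. *)
Definition hemisphere_chart (s : 'cV[R]_(n + 1)) : 'cV[R]_n :=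
  (s (rshift n ord0) 0)^-1 *: usubmx s.

Lemma poincareK : cancel (@poincare R n) hemisphere_chart.
Proof.
move=> x; have x0 := enorm_lift_gt0 x.
rewrite /hemisphere_chart /poincare; apply/colP => i.
rewrite !mxE (unsplitK (inl i)) (unsplitK (inr ord0)) !mxE eqxx mulr1 invrK.
by rewrite mulrA divff ?mul1r // gt_eqF.
Qed.

Lemma hemisphere_scale (s : 'cV[R]_(n + 1)) : hemisphere s ->
  s = s (rshift n ord0) 0 *: col_mx (hemisphere_chart s) 1.
Proof.
move=> [_ s0]; apply/colP => i; rewrite !mxE.
case: splitP => j ij; rewrite !mxE.
  rewrite mulrA divff ?gt_eqF // mul1r; congr (s _ _); exact: val_inj.
rewrite (ord1 j) eqxx mulr1; congr (s _ _); apply: val_inj.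
by rewrite /= ij (ord1 j).
Qed.

Lemma hemisphere_chartK (s : 'cV[R]_(n + 1)) : hemisphere s ->
  poincare (hemisphere_chart s) = s.
Proof.
move=> hs; rewrite [RHS]hemisphere_scale //; case: (hs) => s1 s0.
rewrite /poincare; congr (_ *: _).
(* Taking norms in [hemisphere_scale], the condition [enorm s = 1] identifies the last coordinate
   with the normalising factor of [poincare]. *)
move: s1; rewrite {1}[s]hemisphere_scale // enormZ gtr0_norm // => s1.
apply: (mulIf (lt0r_neq0 (enorm_lift_gt0 (hemisphere_chart s)))).
by rewrite mulVf ?s1 // gt_eqF // enorm_lift_gt0.
Qed.

(** There are finitely many entries, so the entrywise estimates hold simultaneously, and the matrix
    norm is their maximum. *)
Lemma cvg_mx (T : Type) (F : set_system T) {FF : Filter F} (p q : nat)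
    (f : T -> 'M[R]_(p, q)) (l : 'M[R]_(p, q)) :
  (forall i j, f x i j @[x --> F] --> l i j) -> f @ F --> l.
Proof.
move=> fl; apply/cvgrPdist_lt => e e0.
suff: \forall x \near F, `|l - f x| < e by [].
have : \forall x \near F, forall ij : 'I_p * 'I_q,
    `|l ij.1 ij.2 - f x ij.1 ij.2| < e.
  apply: filter_forall => -[i j]; have /cvgrPdist_lt := fl i j; exact.
apply: filterS => x fx.
rewrite /Num.norm /= mx_normrE; apply/bigmax_ltP; split=> // ij _.
by rewrite !mxE.
Qed.

Lemma enorm_continuous (k : nat) : continuous (@enorm R k).
Proof.
move=> y; apply: continuous_comp; last exact: sqrt_continuous.
apply: cvg_big => [||i _]; [exact: add_continuous|exact: nbhs_filter|].
exact: cvg_comp (@coord_continuous _ _ _ i 0 y) (@exprn_continuous _ 2 _).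
Qed.

Lemma poincare_continuous : continuous (@poincare R n).
Proof.
move=> x.
have lift_cvg : col_mx y (1 : 'cV[R]_1) @[y --> x] --> col_mx x (1 : 'cV[R]_1).
  apply: (@cvg_mx _ _ (nbhs_filter x)) => i j.
  under eq_fun do rewrite mxE; rewrite mxE.
  by case: splitP => k _; [exact: coord_continuous | exact: cvg_cst].
apply: (cvgZ (FF := nbhs_filter x) _ lift_cvg).
apply: (@cvgV _ _ _ (nbhs_filter x)); first by rewrite gt_eqF // enorm_lift_gt0.
exact: (cvg_comp _ _ lift_cvg (@enorm_continuous _ _)).
Qed.

Lemma hemisphere_chart_continuous (s : 'cV[R]_(n + 1)) :
  s (rshift n ord0) 0 != 0 -> {for s, continuous hemisphere_chart}.
Proof.
move=> s0; apply: (cvgZ (FF := nbhs_filter s)).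
  by apply: (@cvgV _ _ _ (nbhs_filter s)) => //; exact: coord_continuous.
apply: (@cvg_mx _ _ (nbhs_filter s)) => i j.
under eq_fun do rewrite mxE; rewrite mxE.
exact: coord_continuous.
Qed.

Lemma id_poincare_homeomorphism (C : set (Linfty R m)) :
  homeomorphism_on (C `*` [set: 'cV[R]_n]) (C `*` @hemisphere R n)
    (@id_poincare R n m).
Proof.
split; first split.
- by move=> [u x] [/= Cu _]; split => //; exact: poincare_hemisphere.
- by move=> [u x] [v y] _ _ [/= -> /(can_inj poincareK) ->].
- move=> [u s] [/= Cu hs]; exists (u, hemisphere_chart s) => //.
  by rewrite /id_poincare /= hemisphere_chartK.
- apply: continuous_subspaceT => -[u x].
  apply: (@cvg_pair _ _ _ (nbhs (u, x)) (nbhs u) (nbhs (poincare x))).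
    exact: cvg_fst.
  by apply: cvg_comp; [exact: cvg_snd | exact: poincare_continuous].
- exists (fun p => (p.1, hemisphere_chart p.2)); split.
    apply: continuous_in_subspaceT => -[u s] /set_mem[/= Cu [_ s0]].
    apply: (@cvg_pair _ _ _ (nbhs (u, s)) (nbhs u)
              (nbhs (hemisphere_chart s))); first exact: cvg_fst.
    by apply: cvg_comp; [exact: cvg_snd |
      apply: hemisphere_chart_continuous; rewrite gt_eqF].
  by move=> [u x] _; rewrite /id_poincare /= poincareK.
Qed.

End Homeomorphism.

(** Controls are classes modulo null sets, so the shifted coordinates agree with translated ones
    only almost everywhere; the finitely many exceptional sets are collected, and translation
    preserves null sets. *)
Lemma shift_controls (R : realType) (m : nat) (Omega : set 'cV[R]_m) (t : R)
    (u : Linfty R m) :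
  controls Omega u -> controls Omega (shift_control t u).
Proof.
move=> /(ae_translation t) Ou.
have shiftE : \forall s \ae (@lebesgue_measure R),
    forall i : 'I_m, shift_control t u i s = u i (t + s).
  by apply: filter_forall => i; exact: shift_aeE.
apply: filterS2 shiftE Ou => s shiftE; congr Omega.
by apply/colP => i; rewrite !mxE shiftE.
Qed.

(** * Integrability, oriented integrals and a Gronwall lemma *)

Section Integration.
Context {R : realType}.
Local Notation mu := (@lebesgue_measure R).

Lemma Linfty_ess_bounded (u : LspaceType mu (leey 1)) :
  exists2 C : R, 0 <= C & \forall s \ae mu, `|u s| <= C.
Proof.
have := @Lebesgue_finite _ _ _ _ _ _ u.
rewrite /finite_norm unlock; case: ifPn => [_ ufin|mu0 _]; last first.
  (* In the degenerate branch of the norm the total measure is not positive, so the whole line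
     serves as the null set. *)
  exists 0 => //; exists setT; split => //.
  by apply/eqP; rewrite eq_le measure_ge0 andbT leNgt.
have := @ess_sup_ge _ _ _ mu (abse \o (EFin \o u)).
case: (ess_sup _ _) ufin => [C| |] // _ uC.
- exists `|C| => //; apply: filterS uC => s /=; rewrite lee_fin => uC.
  by apply: le_trans uC _; exact: ler_norm.
- by exists 0 => //; apply: filterS uC => s /=; rewrite leeNy_eq.
Qed.

Lemma measurable_Linfty (u : LspaceType mu (leey 1)) :
  @measurable_fun _ _ (measurableTypeR R) (measurableTypeR R) setT u.
Proof. by rewrite /aqEqMfun_to_fun; exact: measurable_funPT. Qed.

Lemma integrable_continuous_segment (g : R -> R) (a b : R) : continuous g ->
  mu.-integrable `[a, b] (EFin \o g).
Proof.
move=> cg; apply: continuous_compact_integrable; first exact: segment_compact.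
exact: continuous_subspaceT.
Qed.

(** The product is dominated almost everywhere by the continuous function [C * |g|]. *)
Lemma integrable_ess_bounded_mul (u : LspaceType mu (leey 1)) (g : R -> R)
    (a b : R) : continuous g ->
  mu.-integrable `[a, b] (EFin \o (fun s => u s * g s)).
Proof.
move=> cg; have [C C0 uC] := Linfty_ess_bounded u.
have cG : continuous (fun s => C * `|g s|).
  move=> s; apply: cvgM; first exact: cvg_cst.
  by apply: cvg_norm; exact: cg.
have mug : measurable_fun `[a, b] (fun s => u s * g s).
  apply: measurable_funTS; apply: measurable_funM.
    exact: measurable_Linfty.
  exact: continuous_measurable_fun.
apply/integrableP; split; first exact/measurable_EFinP.
have /integrableP[_] := integrable_continuous_segment _ a b cG.
apply: le_lt_trans; apply: ae_ge0_le_integral => //.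
- by do 2 apply: measurableT_comp => //.
- do 2 apply: measurableT_comp => //.
  by apply: measurable_funTS; exact: continuous_measurable_fun.
- apply: filterS uC => s us _ /=.
  by rewrite lee_fin normrM normrM normr_id (ger0_norm C0) ler_wpM2r.
Qed.

Lemma ae_le_normr_Rintegral (f g : R -> R) (a b : R) :
  mu.-integrable `[a, b] (EFin \o f) -> mu.-integrable `[a, b] (EFin \o g) ->
  (forall s, 0 <= g s) -> (\forall s \ae mu, `|f s| <= g s) ->
  `|\int[mu]_(s in `[a, b]) f s| <= \int[mu]_(s in `[a, b]) g s.
Proof.
move=> fi gi g0 fg.
apply: le_trans (le_normr_Rintegral _ fi) _ => //.
have /integrableP[fm ffin] := fi; have /integrableP[gm gfin] := gi.
apply: fine_le.
- by rewrite ge0_fin_numE //; apply: integral_ge0 => s _; rewrite lee_fin.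
- rewrite ge0_fin_numE; last by apply: integral_ge0 => s _; rewrite lee_fin.
  under eq_integral => s _ do rewrite -[g s]ger0_norm //.
  exact: gfin.
apply: ae_ge0_le_integral => //.
- apply/measurable_EFinP; apply: measurableT_comp => //.
  exact/measurable_EFinP.
- by move=> s _; rewrite lee_fin.
- by apply: (@filterS _ _ (ae_filter_ringOfSetsType mu) _ _ _ fg) => s ? _;
  rewrite lee_fin.
Qed.

(* Induction on [j] with steps [r] such that [K * r <= 1 / 2]: if [phi] vanishes
   up to [j * r], its maximum up to [(j + 1) * r] is at most half of itself. *)
Lemma gronwall_zero (phi : R -> R) (K : R) : 0 <= K -> continuous phi ->
  (forall t, 0 <= phi t) ->
  (forall t, 0 <= t -> phi t <= K * \int[mu]_(s in `[0, t]) phi s) ->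
  forall t, 0 <= t -> phi t = 0.
Proof.
move=> K0 cphi phi0 phiK.
have Kr : exists2 r : R, 0 < r & K * r <= 1 / 2.
  (* The summand 1 keeps the denominator positive when [K] is 0. *)
  exists (2 * (K + 1))^-1; first by rewrite invr_gt0; lra.
  rewrite invfM mulrCA mul1r ler_piMr ?invr_ge0 //.
  by rewrite ler_pdivrMr; lra.
have [r r0 {}Kr] := Kr.
suff H j s : 0 <= s <= j%:R * r -> phi s = 0.
  move=> t t0; have tN := archi_boundP (divr_ge0 t0 (ltW r0)).
  apply: (H (Num.bound (t / r))); rewrite t0 /= -ler_pdivrMr //; exact: ltW.
elim: j s => [|j IH] s /andP[s0 sj].
  have -> : s = 0 by move: sj; rewrite mul0r; lra.
  apply/eqP; rewrite eq_le phi0 andbT.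
  by have := phiK 0 (lexx _); rewrite set_itv1 Rintegral_set1 mulr0.
have jr0 : 0 <= j%:R * r by rewrite mulr_ge0 // ltW.
have [||c /[!in_itv] /= /andP[c0 cj] cmax] := @EVT_max R phi 0 (j.+1%:R * r).
- exact: le_trans s0 sj.
- exact: continuous_subspaceT.
have phis : phi s <= phi c by apply: cmax; rewrite in_itv /= s0.
suff phic0 : phi c <= 0.
  by apply/eqP; rewrite eq_le phi0 andbT; exact: le_trans phis phic0.
have [cjr|jrc] := leP c (j%:R * r); first by rewrite IH // c0.
have phi_int a b := integrable_continuous_segment phi a b cphi.
have phi_int' : mu.-integrable `]j%:R * r, c] (EFin \o phi).
  by apply: integrableS (phi_int (j%:R * r) c) => //; exact: subset_itv_oc_cc.
have split_int : \int[mu]_(t in `[0, c]) phi t =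
    \int[mu]_(t in `]j%:R * r, c]) phi t.
  rewrite -(@Rintegral_itvB _ phi (BLeft 0) (BRight c) (j%:R * r)) ?bnd_simp //;
    last exact: ltW.
  rewrite [X in _ - X](_ : _ = 0) ?subr0 //.
  rewrite (@eq_Rintegral _ _ _ _ _ (cst 0)) ?Rintegral_cst ?mul0r //.
  by move=> t /[!inE] /=; rewrite in_itv /=; exact: IH.
have int_le : \int[mu]_(t in `]j%:R * r, c]) phi t <= phi c * r.
  apply: (@le_trans _ _ (\int[mu]_(t in `]j%:R * r, c]) phi c)).
    apply: le_Rintegral => //.
      apply: integrableS (integrable_continuous_segment (cst (phi c))
                            (j%:R * r) c _) => //.
        exact: subset_itv_oc_cc.
      by move=> x; exact: cvg_cst.
    move=> t /=; rewrite in_itv /= => /andP[jt tc]; apply: cmax.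
    by rewrite in_itv /= (le_trans tc cj) andbT (le_trans jr0 (ltW jt)).
  have := @lebesgue_measure_itv R `]j%:R * r, c]; rewrite /= lte_fin jrc => muI.
  rewrite Rintegral_cst // [X in fine X](_ : _ = (c - j%:R * r)%:E) /=;
    last exact: muI.
  apply: ler_wpM2l => //; move: cj; rewrite -natr1; lra.
have := phiK c c0; rewrite split_int => phic.
have : phi c <= K * r * phi c.
  apply: le_trans phic _; rewrite -mulrA [r * _]mulrC.
  exact: ler_wpM2l.
have : K * r * phi c <= 1 / 2 * phi c by exact: ler_wpM2r.
lra.
Qed.

Definition segment_integrable (f : R -> R) :=
  forall a b : R, mu.-integrable `[a, b] (EFin \o f).

Lemma segment_integrableB (f g : R -> R) :
  segment_integrable f -> segment_integrable g ->
  segment_integrable (fun s => f s - g s).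
Proof.
move=> fi gi a b.
rewrite (_ : EFin \o _ = (fun s => (EFin \o f) s - (EFin \o g) s)%E).
  exact: integrableB.
by apply/funext => s /=; rewrite EFinB.
Qed.

Lemma oriented_integralB (f g : R -> R) (t : R) :
  segment_integrable f -> segment_integrable g ->
  oriented_integral (fun s => f s - g s) t =
  oriented_integral f t - oriented_integral g t.
Proof.
move=> fi gi; rewrite /oriented_integral.
by case: ifP => _; rewrite RintegralB //; ring.
Qed.

Lemma oriented_integralZl (c : R) (f : R -> R) (t : R) :
  segment_integrable f ->
  oriented_integral (fun s => c * f s) t = c * oriented_integral f t.
Proof.
move=> fi; rewrite /oriented_integral.
by case: ifP => _; rewrite RintegralZl //; ring.
Qed.

(** Reversing time lets [gronwall_zero], which concerns nonnegative times, cover negative ones. *)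
Lemma Rintegral_reflect (phi : R -> R) (t : R) : t <= 0 -> continuous phi ->
  \int[mu]_(s in `[t, 0]) phi s = \int[mu]_(s in `[0, - t]) phi (- s).
Proof.
move=> t0 cphi; congr fine.
have := @integration_by_substitution_oppr R phi 0 (- t).
rewrite oppr0 opprK => -> //; first by rewrite oppr_ge0.
exact: continuous_subspaceT.
Qed.

End Integration.

(** * Algebra and integrability of the affine right-hand side *)

Section AffineRhs.
Context {R : realType} {n m : nat}.
Variables (A : 'I_m.+1 -> 'M[R]_n) (a : 'I_m.+1 -> 'cV[R]_n).
Local Notation mu := (@lebesgue_measure R).

Lemma affine_rhsE (w : 'cV[R]_m) (x : 'cV[R]_n) (i : 'I_n) :
  affine_rhs A a w x i 0 = (A ord0 *m x + a ord0) i 0 +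
    \sum_(k < m) w k 0 * (A (lift ord0 k) *m x + a (lift ord0 k)) i 0.
Proof.
rewrite mxE summxE; congr (_ + _).
by apply: eq_bigr => k _; rewrite mxE.
Qed.

(** The inhomogeneous terms cancel, so differences of trajectories obey the linear system, encoded
    as the affine one with zero vectors. *)
Lemma affine_rhsB (w : 'cV[R]_m) (x y : 'cV[R]_n) :
  affine_rhs A a w x - affine_rhs A a w y = affine_rhs A (fun=> 0) w (x - y).
Proof.
rewrite /affine_rhs opprD addrACA addr0 -sumrB mulmxBr; congr (_ + _).
  by rewrite opprD addrACA subrr addr0.
apply: eq_bigr => k _; rewrite -scalerBr addr0 mulmxBr; congr (_ *: _).
by rewrite opprD addrACA subrr addr0.
Qed.

Lemma affine_rhs_coordB (w : 'cV[R]_m) (x y : 'cV[R]_n) (i : 'I_n) :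
  affine_rhs A a w x i 0 - affine_rhs A a w y i 0 =
  affine_rhs A (fun=> 0) w (x - y) i 0.
Proof. by rewrite -affine_rhsB [RHS]mxE [X in _ = _ + X]mxE. Qed.

(** Along a continuous curve, the drift is continuous and each control term is an essentially
    bounded function times a continuous one. *)
Lemma affine_rhs_segment_integrable (u : Linfty R m) (x : R -> 'cV[R]_n)
    (i : 'I_n) : continuous x ->
  segment_integrable (fun s => affine_rhs A a (control_at u s) (x s) i 0).
Proof.
move=> cx b c.
have cg k : continuous (fun s => (A k *m x s + a k) i 0).
  have -> : (fun s => (A k *m x s + a k) i 0) =
      (fun s => \sum_j A k i j * x s j 0 + a k i 0).
    by apply/funext => s; rewrite mxE mxE.
  move=> s; apply: cvgD; last exact: cvg_cst.
  apply: cvg_big => [|j _]; first exact: add_continuous.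
  apply: cvgM; first exact: cvg_cst.
  exact: (cvg_comp _ _ (cx s) (@coord_continuous _ _ _ j 0 (x s))).
have -> : EFin \o (fun s => affine_rhs A a (control_at u s) (x s) i 0) =
    (fun s => ((A ord0 *m x s + a ord0) i 0)%R%:E + \sum_(k < m)
      (u k s * (A (lift ord0 k) *m x s + a (lift ord0 k)) i 0)%R%:E)%E.
  apply/funext => s /=; rewrite affine_rhsE EFinD; congr (_ + _)%E.
  by rewrite -sumEFin; apply: eq_bigr => k _; rewrite mxE.
apply: integrableD => //; first exact: integrable_continuous_segment.
apply: integrable_sum => // k _; exact: integrable_ess_bounded_mul.
Qed.

Lemma ler_mulmx_norm (M : 'M[R]_n) (y : 'cV[R]_n) (i : 'I_n) :
  `|(M *m y) i 0| <= (\sum_j `|M i j|) * `|y|.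
Proof.
rewrite mxE mulr_suml; apply: le_trans (ler_norm_sum _ _ _) _.
apply: ler_sum => j _; rewrite normrM ler_wpM2l //.
rewrite [leRHS]/Num.norm /= mx_normrE.
exact: (le_bigmax _ (fun ij => `|y ij.1 ij.2|) (j, 0)).
Qed.

End AffineRhs.

(** * Uniqueness of trajectories of the affine system *)

Section Uniqueness.
Context {R : realType} {n m : nat}.
Variables (A : 'I_m.+1 -> 'M[R]_n) (a : 'I_m.+1 -> 'cV[R]_n).
Local Notation mu := (@lebesgue_measure R).

(** The exceptional null set comes from the bounds on the [m] control coordinates alone. It is
    therefore independent of [y], and the estimate can be used along a moving point. *)
Lemma linear_rhs_ess_bounded (u : Linfty R m) : exists2 K : R, 0 <= K &
  \forall s \ae mu, forall (y : 'cV[R]_n) (i : 'I_n),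
    `|affine_rhs A (fun=> 0) (control_at u s) y i 0| <= K * `|y|.
Proof.
have uC k : exists c : R, 0 <= c /\ \forall s \ae mu, `|u k s| <= c.
  by have [c c0 uc] := Linfty_ess_bounded (u k); exists c.
have [C CP] := boolp.choice uC.
pose S k : R := \sum_i \sum_j `|A k i j|.
have S_ge k i : \sum_j `|A k i j| <= S k.
  rewrite /S [leRHS](bigD1 i) //= lerDl; apply: sumr_ge0 => i' _.
  by apply: sumr_ge0.
have S0 k : 0 <= S k by apply: sumr_ge0 => i _; exact: sumr_ge0.
have AS k (y : 'cV[R]_n) i : `|(A k *m y) i 0| <= S k * `|y|.
  by apply: le_trans (ler_mulmx_norm _ _ _) _; rewrite ler_wpM2r.
clearbody S.
exists (S ord0 + \sum_(k < m) C k * S (lift ord0 k)).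
  rewrite addr_ge0 //; apply: sumr_ge0 => k _.
  by rewrite mulr_ge0 //; case: (CP k).
have {}uC : \forall s \ae mu, forall k, `|u k s| <= C k.
  by apply: filter_forall => k; case: (CP k).
move: uC; apply: filterS => s uC y i; rewrite affine_rhsE /=.
rewrite addr0 mulrDl mulr_suml.
apply: le_trans (ler_normD _ _) _; apply: lerD; first exact: AS.
apply: le_trans (ler_norm_sum _ _ _) _; apply: ler_sum => k _.
by rewrite addr0 normrM /control_at mxE -mulrA; apply: ler_pM.
Qed.

(** The initial values cancel in [e = x - y], so the norm of [e t] is at most [K] times the integral
    of the norm of [e] between 0 and [t]. *)
Lemma trajectory_unique (u : Linfty R m) (x0 : 'cV[R]_n)
    (x y : R -> 'cV[R]_n) :
  is_trajectory (affine_rhs A a) u x0 x ->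
  is_trajectory (affine_rhs A a) u x0 y -> x = y.
Proof.
move=> [cx xE] [cy yE].
pose e s := x s - y s.
have ce : continuous e by move=> s; apply: cvgB; [exact: cx | exact: cy].
pose phi s := `|e s|.
have phi0 s : 0 <= phi s by exact: normr_ge0.
have cphi : continuous phi by move=> s; apply: cvg_norm; exact: ce.
have [K K0 rhsK] := linear_rhs_ess_bounded u.
pose f i s := affine_rhs A (fun=> 0) (control_at u s) (e s) i 0.
have fi i b c : mu.-integrable `[b, c] (EFin \o f i).
  rewrite (_ : f i = (fun s => affine_rhs A a (control_at u s) (x s) i 0 -
                      affine_rhs A a (control_at u s) (y s) i 0)).
    by apply: segment_integrableB; exact: affine_rhs_segment_integrable.
  by apply/funext => s; rewrite /f -(affine_rhs_coordB A a).
have eE i t : e t i 0 = oriented_integral (f i) t.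
  rewrite mxE mxE xE yE opprD addrACA subrr add0r.
  rewrite -oriented_integralB; try exact: affine_rhs_segment_integrable.
  congr oriented_integral; apply/funext => s.
  by rewrite /f -(affine_rhs_coordB A a).
have f_le i b c : `|\int[mu]_(s in `[b, c]) f i s| <=
    K * \int[mu]_(s in `[b, c]) phi s.
  rewrite -RintegralZl //; last exact: integrable_continuous_segment.
  apply: ae_le_normr_Rintegral => //.
  - apply: integrable_continuous_segment => s.
    by apply: cvgM; [exact: cvg_cst | exact: cphi].
  - by move=> s; apply: mulr_ge0.
  - apply: (@filterS _ _ (ae_filter_ringOfSetsType mu) _ _ _ rhsK) => s rs.
    exact: rs.
have norm_le (y' : 'cV[R]_n) (c : R) : 0 <= c -> (forall i, `|y' i 0| <= c) ->
    `|y'| <= c.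
  move=> c0 yc; rewrite [leLHS]/Num.norm /= mx_normrE.
  by apply/bigmax_leP; split=> // -[i j] _ /=; rewrite (ord1 j).
have phi_fwd t : 0 <= t -> phi t = 0.
  apply: (gronwall_zero phi K) => // s s0.
  apply: norm_le => [|i]; first by rewrite mulr_ge0 //; apply: Rintegral_ge0.
  by rewrite eE /oriented_integral s0; exact: f_le.
have phi_bwd t : 0 <= t -> phi (- t) = 0.
  apply: (gronwall_zero (fun s => phi (- s)) K) => // [s|s s0].
    by apply: continuous_comp; [exact: opp_continuous | exact: cphi].
  have s0' : - s <= 0 by rewrite oppr_le0.
  have -> : \int[mu]_(r in `[0, s]) phi (- r) = \int[mu]_(r in `[- s, 0]) phi r.
    by rewrite Rintegral_reflect // opprK.
  apply: norm_le => [|i]; first by rewrite mulr_ge0 //; apply: Rintegral_ge0.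
  (* At time [- s] the forward branch of [oriented_integral] is taken only when [s = 0]. *)
  rewrite eE /oriented_integral; case: ifP => [ns0|_].
    have -> : s = 0 by lra.
    by rewrite oppr0; exact: f_le.
  by rewrite normrN; exact: f_le.
apply/funext => t; apply/eqP; rewrite -subr_eq0 -normr_eq0; apply/eqP.
have [t0|t0] := leP 0 t; first exact: phi_fwd.
by rewrite -[t]opprK; apply: phi_bwd; rewrite oppr_ge0 ltW.
Qed.

End Uniqueness.

(** * Correspondence between affine and induced trajectories *)

Section Induced.
Context {R : realType} {n m : nat}.
Variables (A : 'I_m.+1 -> 'M[R]_n) (a : 'I_m.+1 -> 'cV[R]_n).

Lemma induced_rhs_lift (w : 'cV[R]_m) (c : R) (x : 'cV[R]_n) :
  induced_rhs A a w (c *: col_mx x 1) = c *: col_mx (affine_rhs A a w x) 0.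
Proof.
have mxE_lift k : induced_mx A a k *m (c *: col_mx x 1) =
    c *: col_mx (A k *m x + a k) 0.
  by rewrite -scalemxAr mul_block_col !mul0mx mulmx1 addr0.
rewrite /induced_rhs mxE_lift.
under eq_bigr do rewrite mxE_lift scalerA mulrC -scalerA.
rewrite -scaler_sumr -scalerDr; congr (_ *: _).
apply/colP => i; rewrite [LHS]mxE summxE; case: (split_ordP i) => j ->.
  rewrite !col_mxEu affine_rhsE; congr (_ + _); apply: eq_bigr => k _.
  by rewrite mxE col_mxEu.
rewrite !col_mxEd mxE add0r big1 // => k _.
by rewrite mxE col_mxEd mxE mulr0.
Qed.

(** The bottom block row is zero. As [y] is arbitrary, the last coordinate of any induced trajectory
    is constant before its form is known. *)
Lemma induced_rhs_last (w : 'cV[R]_m) (y : 'cV[R]_(n + 1)) :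
  induced_rhs A a w y (rshift n ord0) 0 = 0.
Proof.
have last0 k : (induced_mx A a k *m y) (rshift n ord0) 0 = 0.
  by rewrite -[y]vsubmxK mul_block_col !mul0mx addr0 col_mxEd mxE.
rewrite mxE last0 add0r summxE big1 // => k _.
by rewrite mxE last0 mulr0.
Qed.

Lemma oriented_integral0 (t : R) : oriented_integral (fun=> 0) t = 0 :> R.
Proof.
rewrite /oriented_integral.
by case: ifP => _; rewrite Rintegral_cst // mul0r ?oppr0.
Qed.

Lemma is_trajectory_lift (u : Linfty R m) (s : 'cV[R]_(n + 1))
    (x : R -> 'cV[R]_n) : hemisphere s ->
  is_trajectory (affine_rhs A a) u (hemisphere_chart s) x ->
  is_trajectory (induced_rhs A a) u s
    (fun t => s (rshift n ord0) 0 *: col_mx (x t) 1).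
Proof.
move=> hs [cx xE]; set c := s _ _; split.
  move=> t; apply: (cvgZ (FF := nbhs_filter t)); first exact: cvg_cst.
  apply: (@cvg_mx _ _ _ (nbhs_filter t)) => i j.
  under eq_fun do rewrite mxE; rewrite mxE.
  case: splitP => k _; last exact: cvg_cst.
  exact: (cvg_comp _ _ (cx t) (@coord_continuous _ _ _ k j (x t))).
move=> t i; case: (split_ordP i) => j ->.
  have -> : s (lshift 1 j) 0 = c * hemisphere_chart s j 0.
    by rewrite [in LHS](hemisphere_scale s hs) mxE col_mxEu.
  rewrite mxE col_mxEu xE mulrDr -oriented_integralZl;
    last exact: affine_rhs_segment_integrable.
  congr (_ + oriented_integral _ _); apply/funext => r.
  by rewrite induced_rhs_lift [in RHS]mxE col_mxEu.
rewrite (ord1 j) mxE col_mxEd mxE eqxx mulr1.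
under eq_fun do rewrite induced_rhs_last.
by rewrite oriented_integral0 addr0.
Qed.

(** The last coordinate keeps its positive initial value [c]; dividing the other coordinates by [c]
    gives the affine trajectory. *)
Lemma is_trajectory_descend (u : Linfty R m) (s : 'cV[R]_(n + 1))
    (y : R -> 'cV[R]_(n + 1)) : hemisphere s ->
  is_trajectory (induced_rhs A a) u s y ->
  exists2 x : R -> 'cV[R]_n,
    is_trajectory (affine_rhs A a) u (hemisphere_chart s) x &
    y = fun t => s (rshift n ord0) 0 *: col_mx (x t) 1.
Proof.
move=> hs [cy yE]; set c := s _ _.
have c0 : c != 0 by case: hs => _ s0; rewrite gt_eqF.
have y_last t : y t (rshift n ord0) 0 = c.
  rewrite yE; under eq_fun do rewrite induced_rhs_last.
  by rewrite oriented_integral0 addr0.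
pose x t := c^-1 *: usubmx (y t).
have yx : y = fun t => c *: col_mx (x t) 1.
  apply/funext => t; rewrite scale_col_mx scalerA divff // scale1r.
  rewrite -[LHS]vsubmxK; congr col_mx; apply/colP => i.
  by rewrite (ord1 i) !mxE y_last eqxx mulr1.
have cx : continuous x.
  move=> t; apply: (cvgZ (FF := nbhs_filter t)); first exact: cvg_cst.
  apply: (@cvg_mx _ _ _ (nbhs_filter t)) => i j.
  under eq_fun do rewrite mxE; rewrite mxE.
  exact: (cvg_comp _ _ (cy t) (@coord_continuous _ _ _ _ j (y t))).
exists x => //; split => // t i.
rewrite [LHS]mxE [in LHS]mxE yE mulrDr; congr (_ + _); first by rewrite !mxE.
(* The factor [c] is inserted on the affine side, where integrability is known, so that it can be
   moved under the integral. *)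
rewrite -[RHS](mulKf c0); congr (_ * _).
rewrite -oriented_integralZl; last exact: affine_rhs_segment_integrable.
congr oriented_integral; apply/funext => r.
by rewrite yx induced_rhs_lift [in LHS]mxE col_mxEu.
Qed.

Lemma enorm_poincare_scale (c : R) (x : 'cV[R]_n) : 0 < c ->
  (enorm (c *: col_mx x (1 : 'cV[R]_1)))^-1 *: (c *: col_mx x 1) = poincare x.
Proof.
move=> c0; rewrite /poincare enormZ gtr0_norm // scalerA invfM mulrAC.
by rewrite mulVf ?mul1r // gt_eqF.
Qed.

(* If there is no trajectory through [x0], both sides are default values of
   [xget], and these correspond to each other. *)
Lemma poincare_psi (t : R) (x0 : 'cV[R]_n) (u : Linfty R m) :
  poincare (psi A a t x0 u) = Spsi1 A a t (poincare x0) u.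
Proof.
have hs := poincare_hemisphere x0; have [s1 s0] := hs.
rewrite /Spsi1 /psi1 /psi /trajectory.
have [[x xP]|noaff] := pselect (exists x,
    is_trajectory (affine_rhs A a) u x0 x).
- have -> : xget (fun=> x0) [set x | is_trajectory (affine_rhs A a) u x0 x] = x.
    apply: xget_unique => // y yP.
    exact: (trajectory_unique _ _ _ _ _ _ yP xP).
  have liftP : is_trajectory (induced_rhs A a) u (poincare x0)
      (fun r => poincare x0 (rshift n ord0) 0 *: col_mx (x r) 1).
    by apply: is_trajectory_lift; rewrite ?poincareK.
  rewrite (@xget_unique _ _ _ (fun r =>
    poincare x0 (rshift n ord0) 0 *: col_mx (x r) 1)) //.
    by rewrite enorm_poincare_scale.
  (* Uniqueness for the induced system is inherited: any competitor descends to an affine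
     trajectory, which must be [x]. *)
  move=> y /(is_trajectory_descend _ _ _ hs); rewrite poincareK => -[x' x'P ->].
  by rewrite (trajectory_unique _ _ _ _ _ _ x'P xP).
(* The default on the sphere is the constant curve [poincare x0], of norm 1, which normalisation
   leaves unchanged. *)
- rewrite !xgetPN ?s1 ?invr1 ?scale1r //.
    move=> y /(is_trajectory_descend _ _ _ hs); rewrite poincareK => -[x xP _].
    by apply: noaff; exists x.
  by move=> x xP; apply: noaff; exists x.
Qed.

End Induced.

Theorem theorem6 (R : realType) (n m : nat)
    (A : 'I_m.+1 -> 'M[R]_n) (a : 'I_m.+1 -> 'cV[R]_n)
    (Omega : set 'cV[R]_m)
    (Omega_convex : convex_set Omega)
    (Omega_compact : compact Omega)
    (Omega_nbhs0 : nbhs (0 : 'cV[R]_m) Omega)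
    (dU : Linfty R m -> Linfty R m -> R)
    (dU_metric : metric_on (controls Omega) dU)
    (dU_weak_star : compatible_on (controls Omega) dU) :
  let X := controls Omega `*` [set: 'cV[R]_n] in
  let X' := controls Omega `*` @hemisphere R n in
  topological_conjugation X X' (Psi A a) (SPsi1 A a) (@id_poincare R n m) /\
  [set @id_poincare R n m @` Y | Y in
    maximal_invariant_sct X (max_dist dU) (Psi A a)] =
  maximal_invariant_sct X' (max_dist dU) (SPsi1 A a).
Proof.
move=> X X'.
have conj : topological_conjugation X X' (Psi A a) (SPsi1 A a)
    (@id_poincare R n m).
  split; first exact: id_poincare_homeomorphism.
  by move=> t [u x] _; rewrite /id_poincare /Psi /SPsi1 /= poincare_psi.
split=> //; apply: maximal_invariant_sct_conjugation => //.
- exact: metric_on_max_dist.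
- exact: metric_on_max_dist.
- exact: compatible_on_max_dist.
- exact: compatible_on_max_dist.
- by move=> t [u x] [/= Cu _]; split => //; exact: shift_controls.
Qed.
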